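(* Let $G$ be a connected graph with vertex set $\{v_1,\dots,v_n\}$, $n\ge 2$, and for $i=1,\dots,n$ let $H_i$ be an $r_i$-regular graph of order $p_i$ with $r_i\ge 1$. Let $\mathsf{G}=G[H_1,\dots,H_n]$, and let $n_k$ denote the order of $\mathcal{L}^k(\mathsf{G})$. Then $\mathcal{L}^k(\mathsf{G})$ has property $\varrho$ for every $k\ge 1$. Moreover, for every $k\ge 0$ and every graph $G'$ of order $n_k$ and size $m'_k$ that contains $\mathcal{L}^k(\mathsf{G})$ as a spanning subgraph, the line graph $\mathcal{L}(G')$ has property $\varrho$ and energy $\mathcal{E}(\mathcal{L}(G'))=4(m'_k-n_k)$; in particular all such line graphs $\mathcal{L}(G')$ with the same $m'_k$ are mutually equienergetic.
   Context: $G[H_1,\dots,H_n]$ ($H$-join) is obtained from the disjoint union of $H_1,\dots,H_n$ by joining every vertex of $H_i$ to every vertex of $H_j$ whenever $v_iv_j\in E(G)$. $\mathcal{L}(X)$ is the line graph; $\mathcal{L}^0=\mathrm{id}$, $\mathcal{L}^k(X)=\mathcal{L}(\mathcal{L}^{k-1}(X))$. A graph has property $\varrho$ if all its negative adjacency eigenvalues equal $-2$. Energy $\mathcal{E}(X)$ is the sum of absolute values of adjacency eigenvalues. *)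

(* Defs.v *)
From HB Require Import structures.
From mathcomp Require Import all_boot all_order all_algebra.
Set Implicit Arguments.
Unset Strict Implicit.
Unset Printing Implicit Defensive.
Import Order.TTheory GRing.Theory Num.Theory.
Local Open Scope ring_scope.

(* The vertex type may be empty, so that the line graph is total: the line
   graph of an edgeless graph has no vertex. *)
Record sgraph := SGraph {
  vertex :> finType;
  adj : rel vertex;
  adj_sym : symmetric adj;
  adj_irr : irreflexive adj }.

Definition edges (X : sgraph) : {set {set X}} :=
  [set e | [exists x : X, [exists y : X, adj x y && (e == [set x; y])]]].

Definition gorder (X : sgraph) : nat := #|X|.
Definition gsize (X : sgraph) : nat := #|edges X|.

Definition gconnected (X : sgraph) : Prop :=
  forall x y : X, connect (@adj X) x y.

Definition regular (X : sgraph) (r : nat) : Prop :=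
  forall x : X, #|[set y | adj x y]| = r.

Section GraphJoin.
Variables (G : sgraph) (H : G -> sgraph).

Definition gjoin_vertex : finType := {i : G & H i}.

(* tagged_as u v is tagged v transported to H (tag u); it is only used when
   tag u == tag v. *)
Definition gjoin_adj (u v : gjoin_vertex) : bool :=
  adj (tag u) (tag v)
  || (tag u == tag v) && adj (tagged u) (tagged_as u v).

Lemma gjoin_adj_sym : symmetric gjoin_adj.
Proof.
move=> [i x] [j y]; rewrite /gjoin_adj /= adj_sym eq_sym.
case: eqVneq => [eq_ji|] //=; case: _ / eq_ji y => y in x *.
by rewrite !tagged_asE adj_sym.
Qed.

Lemma gjoin_adj_irr : irreflexive gjoin_adj.
Proof. by move=> [i x]; rewrite /gjoin_adj /= tagged_asE !adj_irr andbF. Qed.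

Definition gjoin : sgraph := SGraph gjoin_adj_sym gjoin_adj_irr.
End GraphJoin.

Section LineGraph.
Variable X : sgraph.

Definition line_vertex : finType := {e : {set X} | e \in edges X}.

Definition line_adj (e f : line_vertex) : bool :=
  (e != f) && (val e :&: val f != set0).

Lemma line_adj_sym : symmetric line_adj.
Proof. by move=> e f; rewrite /line_adj eq_sym setIC. Qed.

Lemma line_adj_irr : irreflexive line_adj.
Proof. by move=> e; rewrite /line_adj eqxx. Qed.

Definition line_graph : sgraph := SGraph line_adj_sym line_adj_irr.
End LineGraph.

Definition iter_line (k : nat) (X : sgraph) : sgraph := iter k line_graph X.

(* X is, up to isomorphism, a spanning subgraph of Y. *)
Definition spanning_subgraph (X Y : sgraph) : Prop :=
  exists f : X -> Y, bijective f /\ forall x y : X, adj x y -> adj (f x) (f y).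

Section Spectrum.
Variables (C : numClosedFieldType) (X : sgraph).

Definition adjmx : 'M[C]_#|X| :=
  \matrix_(i, j) (adj (enum_val i) (enum_val j))%:R.

(* The roots of the (monic) characteristic polynomial, repeated according to
   their multiplicities. *)
Definition spectrum : seq C :=
  sval (closed_field_poly_normal (char_poly adjmx)).

Lemma spectrumE : char_poly adjmx = \prod_(a <- spectrum) ('X - a%:P).
Proof.
rewrite /spectrum; case: closed_field_poly_normal => s /= {1}->.
by rewrite (monicP (char_poly_monic _)) scale1r.
Qed.

Lemma mem_spectrum (a : C) : (a \in spectrum) = eigenvalue adjmx a.
Proof. by rewrite eigenvalue_root_char spectrumE root_prod_XsubC. Qed.

Definition energy : C := \sum_(a <- spectrum) `|a|.

(* In C, a < 0 means that a is real and negative. *)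
Definition property_rho : Prop :=
  forall a : C, eigenvalue adjmx a -> a < 0 -> a = - 2%:R.
End Spectrum.

Definition equienergetic (C : numClosedFieldType) (X Y : sgraph) : Prop :=
  gorder X = gorder Y /\ energy C X = energy C Y.

(* Main.v *)
(* If B is the incidence matrix of X, then B B^T = D + A is the signless Laplacian
   of X and B^T B = A(L(X)) + 2 I.  Hence, when D + A >= 2 I, the eigenvalues of
   L(X) are nonnegative or equal to -2, the latter with multiplicity m - n since
   B B^T is invertible; as the trace vanishes, the energy is 4 (m - n).
   The bound D + A >= 2 I passes to spanning supergraphs.  It holds for the join
   by splitting a vector into its mean on each H_i and the deviation from it, and
   it holds for every line graph L(X) with X of minimum degree at least 3, because
   then L(X) has minimum degree at least 4 and A(L(X)) >= -2 I. *)
Require Import Defs.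
From mathcomp Require Import all_boot all_order all_algebra.
From mathcomp Require Import ring.
Set Implicit Arguments.
Unset Strict Implicit.
Unset Printing Implicit Defensive.
Import Order.TTheory GRing.Theory Num.Theory.
Local Open Scope ring_scope.

(** * Edges, incidence sums and degrees in line graphs *)

Definition degree (X : sgraph) (x : X) : nat := #|[set y | adj x y]|.

Lemma adj_neq (X : sgraph) (x y : X) : adj x y -> x != y.
Proof. by apply: contraTneq => ->; rewrite adj_irr. Qed.

Lemma edgesP (X : sgraph) (e : {set X}) :
  reflect (exists x y : X, adj x y /\ e = [set x; y]) (e \in edges X).
Proof.
rewrite inE; apply: (iffP existsP) => [[x /existsP [y /andP [xy /eqP ->]]]|].
  by exists x, y.
by move=> [x [y [xy ->]]]; exists x; apply/existsP; exists y; rewrite xy eqxx.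
Qed.

Lemma sum_line_graph (V : nmodType) (X : sgraph) (P : pred {set X})
    (F : {set X} -> V) :
  \sum_(e : line_graph X | P (val e)) F (val e)
    = \sum_(e in edges X | P e) F e.
Proof. by rewrite [RHS]big_sub_cond. Qed.

(** The map sending [y] to [[set x; y]] is a bijection from the neighbours of [x] onto the edges at
    [x]. *)
Lemma sum_incident_edges (V : nmodType) (X : sgraph) (x : X)
    (F : {set X} -> V) :
  \sum_(e : line_graph X | x \in val e) F (val e)
    = \sum_(y | adj x y) F [set x; y].
Proof.
rewrite (sum_line_graph (fun e : {set X} => x \in e)).
rewrite -[RHS](big_imset _ (h := fun y => [set x; y])) /=; last first.
  move=> y z xy xz /setP /(_ y); rewrite !inE eqxx orbT.
  by rewrite eq_sym (negPf (adj_neq xy)) => /esym /eqP.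
apply: eq_bigl => e; apply/andP/imsetP => [[/edgesP [a [b [ab ->]]]]|].
  rewrite !inE => /orP [] /eqP ->; first by exists b.
  by exists a; [rewrite adj_sym in ab; exact: ab | rewrite setUC].
move=> [y xy ->]; rewrite in_setU1 eqxx; split=> //.
by apply/edgesP; exists x, y.
Qed.

Lemma card_line_graph (X : sgraph) : #|line_graph X| = gsize X.
Proof. by rewrite card_sig; apply: eq_card. Qed.

(** Edges have two endpoints, so distinct edges share at most one. *)
Lemma card_edgeI (X : sgraph) (e f : line_graph X) :
  #|val e :&: val f| = ((e == f).*2 + adj e f)%N.
Proof.
have sz2 (g : line_graph X) : #|val g| = 2%N.
  by have /edgesP [x [y [xy ->]]] := valP g; rewrite cards2 adj_neq.
rewrite /adj /= /line_adj; case: (eqVneq e f) => [->|ef] /=.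
  by rewrite setIid sz2.
case: (eqVneq (val e :&: val f) set0) => [->|] /=; first by rewrite cards0.
rewrite -card_gt0 => gt0; apply/eqP; rewrite eqn_leq gt0 andbT leqNgt.
apply: contra ef => gt1; rewrite -val_eqE.
have eqI (g : line_graph X) : val e :&: val f \subset val g -> val e :&: val f = val g.
  by move=> sub; apply/eqP; rewrite eqEcard sub sz2.
by rewrite -(eqI e (subsetIl _ _)) (eqI f (subsetIr _ _)).
Qed.

(* Entrywise [B^T B = A(L(X)) + 2 I], for [B] the incidence matrix of [X]. *)
Lemma sum_incident_line (V : nmodType) (X : sgraph) (v : line_graph X -> V)
    (e : line_graph X) :
  \sum_(x in val e) \sum_(f : line_graph X | x \in val f) v f
    = v e *+ 2 + \sum_(f | adj e f) v f.
Proof.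
rewrite (exchange_big_dep predT) //=.
under eq_bigr => f _.
  rewrite sumr_const (_ : #|_| = #|val e :&: val f|); last first.
    by rewrite -[RHS]cardsE; apply: eq_card => x; rewrite !inE.
  rewrite card_edgeI mulrnDr; over.
rewrite big_split /= (bigD1 e) //= eqxx big1 ?addr0 => [|f]; last first.
  by rewrite eq_sym => /negPf ->.
congr (_ + _); rewrite [RHS]big_mkcond; apply: eq_bigr => f _.
by case: line_adj.
Qed.

Lemma degree_line_graph (X : sgraph) (e : line_graph X) :
  (\sum_(x in val e) degree x = 2 + degree e)%N.
Proof.
rewrite /degree -sum1dep_card.
etransitivity; last exact: (sum_incident_line (fun=> 1%N) e).
apply: eq_bigr => x _; rewrite -sum1dep_card.
by rewrite (sum_incident_edges x (fun=> 1%N)).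
Qed.

Lemma min_degree_line_graph (X : sgraph) :
  (forall x : X, 3 <= degree x)%N -> (forall e : line_graph X, 4 <= degree e)%N.
Proof.
move=> d3 e; rewrite -(leq_add2l 2) -degree_line_graph.
have /edgesP [x [y [xy ->]]] := valP e.
rewrite big_setU1 ?big_set1 ?inE ?adj_neq //=.
exact: (leq_add (d3 x) (d3 y)).
Qed.

(** Clearing the lower left block of [W] by column operations yields [a%:M - M *m N]; clearing it by
    row operations, after scaling the lower rows by [a], yields [a%:M - N *m M]. Nothing is divided
    by [a], so [a] may be a polynomial. *)
Lemma mulmx_char_swap (R : comNzRingType) (m n : nat) (a : R)
    (M : 'M[R]_(n, m)) (N : 'M[R]_(m, n)) :
  a ^+ n * \det (a%:M - N *m M) = a ^+ m * \det (a%:M - M *m N).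
Proof.
pose W := block_mx a%:M M N 1%:M : 'M[R]_(n + m).
have W1 : \det W = \det (a%:M - M *m N).
  have := congr1 determinant (mulmx_block a%:M M N 1%:M 1%:M 0 (- N) 1%:M).
  rewrite det_mulmx det_lblock !det1 !mulr1 => ->.
  by rewrite !mulmx1 !mul1mx !mulmx0 !add0r mulmxN subrr det_ublock det1 mulr1.
have := congr1 determinant (mulmx_block 1%:M 0 (- N) a%:M a%:M M N 1%:M).
rewrite det_mulmx det_lblock W1 det1 mul1r det_scalar => ->.
rewrite !mul1mx !mul0mx !addr0 mulmx1 mulNmx mul_mx_scalar mul_scalar_mx addNr.
by rewrite det_ublock det_scalar mulNmx addrC.
Qed.

(** * The signless Laplacian form and the eigenvalues of line graphs *)

Section SignlessLaplacian.
Variable C : numClosedFieldType.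
Implicit Types X Y : sgraph.

(* The hermitian form of the signless Laplacian [D + A]. *)
Definition signless_form X (v : X -> C) : C :=
  \sum_x \sum_(y | adj x y) (v x + v y) * (v x)^*.

Definition signless_ge2 X : Prop :=
  forall v : X -> C, 2%:R * \sum_x `|v x| ^+ 2 <= signless_form v.

(** Adding the sum to its copy with [x] and [y] exchanged completes each term to a squared modulus.
    Weights other than 1 serve for the join, where they are the products of the orders of two
    parts. *)
Lemma weighted_formE X (c : X -> X -> C) (v : X -> C) :
    (forall x y, c x y = c y x) ->
  \sum_x \sum_(y | adj x y) c x y * ((v x + v y) * (v x)^*)
    = 2%:R^-1 * \sum_x \sum_(y | adj x y) c x y * `|v x + v y| ^+ 2.
Proof.
move=> c_sym; apply: (canRL (mulKf _)); first by rewrite pnatr_eq0.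
rewrite mulr_natl mulr2n [X in _ + X](exchange_big_dep predT) //=.
rewrite -big_split /=; apply: eq_bigr => x _.
under [X in _ + X]eq_bigl do rewrite adj_sym.
rewrite -big_split /=; apply: eq_bigr => y _.
by rewrite normCK rmorphD /= (addrC (v y)) (c_sym y) -mulrDr -mulrDr.
Qed.

Lemma weighted_form_ge0 X (c : X -> X -> C) (v : X -> C) :
    (forall x y, c x y = c y x) -> (forall x y, 0 <= c x y) ->
  0 <= \sum_x \sum_(y | adj x y) c x y * ((v x + v y) * (v x)^*).
Proof.
move=> c_sym c_ge0; rewrite weighted_formE //.
rewrite mulr_ge0 ?invr_ge0 ?ler0n // sumr_ge0 // => x _.
by rewrite sumr_ge0 // => y _; rewrite mulr_ge0 ?exprn_ge0.
Qed.

Lemma signless_formE X (v : X -> C) :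
  signless_form v = 2%:R^-1 * \sum_x \sum_(y | adj x y) `|v x + v y| ^+ 2.
Proof.
have := @weighted_formE X (fun _ _ => 1) v (fun _ _ => erefl).
by under eq_bigr do under eq_bigr do rewrite mul1r;
   under [X in _ = _ * X]eq_bigr do under eq_bigr do rewrite mul1r.
Qed.

Lemma signless_form_ge0 X (v : X -> C) : 0 <= signless_form v.
Proof.
rewrite signless_formE mulr_ge0 ?invr_ge0 ?ler0n // sumr_ge0 // => x _.
by rewrite sumr_ge0 // => y _; rewrite exprn_ge0.
Qed.

(** By [signless_formE] the form is a sum of squares over edges, so additional edges can only
    increase it. *)
Lemma signless_ge2_spanning X Y :
  spanning_subgraph X Y -> signless_ge2 X -> signless_ge2 Y.
Proof.
move=> [f [bij_f adj_f]] X2 v; rewrite signless_formE.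
rewrite !(reindex f (onW_bij _ bij_f)) /=.
apply: le_trans (X2 (v \o f)) _; rewrite signless_formE.
rewrite ler_pM2l ?invr_gt0 ?ltr0n //; apply: ler_sum => x _.
rewrite (reindex f (onW_bij _ bij_f)) /= big_mkcond [leRHS]big_mkcond /=.
apply: ler_sum => y _; case: ifP => [/adj_f -> //|_].
by case: ifP => // _; rewrite exprn_ge0.
Qed.

Lemma eigenvalue_adjmx X (a : C) : eigenvalue (adjmx C X) a ->
  exists2 v : X -> C, exists x, v x != 0
    & forall x, \sum_(y | adj x y) v y = a * v x.
Proof.
move=> /eigenvalueP [v vA /rV0Pn [i vi]].
exists (fun x => v 0 (enum_rank x)) => [|x].
  by exists (enum_val i); rewrite enum_valK.
have /matrixP /(_ 0 (enum_rank x)) := vA; rewrite !mxE => <-.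
rewrite big_mkcond (reindex _ (onW_bij _ (enum_val_bij _))) /=.
apply: eq_bigr => j _; rewrite !mxE enum_rankK enum_valK adj_sym.
by case: adj; rewrite ?mulr1 ?mulr0.
Qed.

(** This is [D + A = B B^T] for the incidence matrix [B]. *)
Lemma signless_form_incident X (v : X -> C) :
  signless_form v = \sum_x (\sum_(e : line_graph X | x \in val e)
                              \sum_(y in val e) v y) * (v x)^*.
Proof.
apply: eq_bigr => x _; rewrite -mulr_suml; congr (_ * _).
rewrite (sum_incident_edges x (fun e : {set X} => \sum_(y in e) v y)).
apply: eq_bigr => y xy.
by rewrite big_setU1 ?big_set1 ?inE ?adj_neq.
Qed.

Lemma sum_norm2_gt0 (T : finType) (v : T -> C) (x : T) :
  v x != 0 -> 0 < \sum_y `|v y| ^+ 2.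
Proof.
move=> vx; rewrite (bigD1 x) //= ltr_pwDl ?exprn_gt0 ?normr_gt0 //.
by rewrite sumr_ge0 // => y _; rewrite exprn_ge0.
Qed.

(** For an eigenvector [v], put [w = B v], so that [B^T w = (a + 2) v]. If [w] vanishes, then
    [a = -2]. Otherwise the form at [w] equals [(a + 2) |w|^2] and is at least [2 |w|^2], so
    [a >= 0]. *)
Lemma eigenvalue_line_graph X (a : C) : signless_ge2 X ->
  eigenvalue (adjmx C (line_graph X)) a -> a = - 2%:R \/ 0 <= a.
Proof.
move=> X2 /eigenvalue_adjmx [v [e ve] eig].
pose w x := \sum_(f : line_graph X | x \in val f) v f.
have Bw (f : line_graph X) : \sum_(x in val f) w x = (a + 2%:R) * v f.
  by rewrite sum_incident_line eig mulrDl mulr_natl addrC.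
case: (pickP (fun x => w x != 0)) => [x wx|w0]; [right | left]; last first.
  have /eqP := Bw e; rewrite big1 => [|x _]; last by apply/eqP/negbFE/w0.
  by rewrite eq_sym mulf_eq0 (negPf ve) orbF addr_eq0 => /eqP.
have := X2 w; rewrite signless_form_incident.
under [leRHS]eq_bigr => y _.
  rewrite (eq_bigr _ (fun f _ => Bw f)) -mulr_sumr -mulrA -normCK; over.
rewrite -mulr_sumr [leRHS]mulrDl lerDr pmulr_lge0 //.
exact: sum_norm2_gt0 wx.
Qed.

Lemma signless_ge2_line_graph X :
  (forall x : X, 3 <= degree x)%N -> signless_ge2 (line_graph X).
Proof.
move=> d3 v; pose w x := \sum_(f : line_graph X | x \in val f) v f.
(* [B^T B] is positive and equals [A + 2], so [D + A >= D - 2 >= 2]. *)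
have psd : 0 <= \sum_e ((v e *+ 2 + \sum_(f | adj e f) v f) * (v e)^*).
  suff -> : \sum_e ((v e *+ 2 + \sum_(f | adj e f) v f) * (v e)^*)
      = \sum_x `|w x| ^+ 2 by rewrite sumr_ge0 // => x _; rewrite exprn_ge0.
  under eq_bigr do rewrite -sum_incident_line mulr_suml.
  rewrite (exchange_big_dep predT) //=; apply: eq_bigr => x _.
  by rewrite -mulr_sumr normCK rmorph_sum.
rewrite -subr_ge0; suff -> : signless_form v - 2%:R * \sum_x `|v x| ^+ 2 =
    \sum_e ((degree e)%:R - 4%:R) * `|v e| ^+ 2
    + \sum_e ((v e *+ 2 + \sum_(f | adj e f) v f) * (v e)^*).
  rewrite addr_ge0 // sumr_ge0 // => e _; rewrite mulr_ge0 ?exprn_ge0 //.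
  by rewrite subr_ge0 ler_nat min_degree_line_graph.
rewrite mulr_sumr -sumrB -big_split /=; apply: eq_bigr => e _.
rewrite -mulr_suml big_split /= sumr_const normCK.
rewrite (_ : #|_| = @degree (line_graph X) e); last first.
  by apply: eq_card => f; rewrite inE.
by ring.
Qed.

(** * Trace, multiplicity of -2 and energy *)

Lemma size_spectrum X : size (spectrum C X) = #|X|.
Proof.
apply/eqP; rewrite -eqSS -(size_char_poly (adjmx C X)) spectrumE.
by rewrite size_prod_XsubC.
Qed.

Lemma sum_spectrum X : \sum_(a <- spectrum C X) a = 0.
Proof.
(* The trace is read off the coefficient of degree [#|X| - 1], so the empty graph is treated
   apart. *)
case: (posnP #|X|) => [X0|X_gt0].
  by move: (size_spectrum X); rewrite X0 => /size0nil ->; rewrite big_nil.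
have := char_poly_trace (adjmx C X) X_gt0.
rewrite spectrumE -{1}size_spectrum coefPn_prod_XsubC ?size_spectrum -?lt0n //.
move/oppr_inj ->; rewrite /mxtrace big1 // => i _.
by rewrite mxE adj_irr.
Qed.

Definition incidence_mx X : 'M[C]_(#|X|, #|line_graph X|) :=
  \matrix_(i, j) (enum_val i \in val (enum_val j : line_graph X))%:R.

Lemma trmx_incidence_mul X :
  (incidence_mx X)^T *m incidence_mx X = adjmx C (line_graph X) + 2%:R%:M.
Proof.
apply/matrixP => i j; rewrite !mxE.
rewrite (_ : \sum_k _ = #|val (enum_val i : line_graph X) :&: val (enum_val j)|%:R);
  last first.
  rewrite -sum1_card natr_sum [RHS]big_mkcond /=.
  rewrite [RHS](reindex _ (onW_bij _ (enum_val_bij _))) /=; apply: eq_bigr => k _.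
  by rewrite !mxE inE -natrM mulnb; case: ifP.
rewrite card_edgeI (inj_eq enum_val_inj) natrD addrC; congr (_ + _).
by case: eqP.
Qed.

(** A vector killed by [B B^T] has zero signless form, hence zero norm by the bound. *)
Lemma incidence_mul_tr_unit X : signless_ge2 X ->
  incidence_mx X *m (incidence_mx X)^T \in unitmx.
Proof.
move=> X2; rewrite -row_free_unit -kermx_eq0; apply/rowV0P => u /sub_kermxP.
rewrite mulmxA => uBB; apply/rowP => i; rewrite mxE; apply/eqP.
pose v x := u 0 (enum_rank x).
suff : v (enum_val i) = 0 by rewrite /v enum_valK => ->.
apply/eqP/negPn/negP => /sum_norm2_gt0 S_gt0.
have := X2 v; rewrite signless_form_incident [leRHS]big1 => [|x _].
  by rewrite pmulr_rle0 ?ltr0n // => /(lt_le_trans S_gt0); rewrite ltxx.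
suff -> : \sum_(e : line_graph X | x \in val e) \sum_(y in val e) v y = 0.
  by rewrite mul0r.
have /matrixP /(_ 0 (enum_rank x)) := uBB; rewrite !mxE => uBBx; rewrite -[RHS]uBBx.
rewrite [LHS]big_mkcond [LHS](reindex _ (onW_bij _ (enum_val_bij _))) /=.
apply: eq_bigr => j _; rewrite !mxE enum_rankK; case: ifP; rewrite ?mulr0 //.
rewrite mulr1 [LHS]big_mkcond [LHS](reindex _ (onW_bij _ (enum_val_bij _))) /= => _.
apply: eq_bigr => k _; rewrite !mxE /v enum_valK.
by case: ifP; rewrite ?mulr1 ?mulr0.
Qed.

(** With [a = 'X + 2], exchanging the factors of [B^T B] in the determinant gives [chE]. At -2 the
    cofactor [q] takes the value [\det (- B B^T)], which is nonzero; the claim compares the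
    multiplicities of the root -2 on both sides. *)
Lemma mult_neg2_spectrum X : signless_ge2 X ->
  (#|X| + count_mem (- 2%:R) (spectrum C (line_graph X)))%N = #|line_graph X|.
Proof.
move=> X2; set B := incidence_mx X; set n := #|X|; set m := #|line_graph X|.
pose a : {poly C} := 'X - (- 2%:R)%:P.
pose q := \det (a%:M - map_mx polyC B *m (map_mx polyC B)^T).
have chE : a ^+ n * char_poly (adjmx C (line_graph X)) = a ^+ m * q.
  rewrite /q -mulmx_char_swap; congr (_ * \det _).
  rewrite /char_poly_mx map_trmx -map_mxM trmx_incidence_mul map_mxD /=.
  rewrite map_scalar_mx /a polyCN opprK raddfD /= opprD addrACA.
  by rewrite [X in _ = _ + X]subrr addr0.
have qN : ~~ root q (- 2%:R).
  rewrite rootE -horner_evalE -det_map_mx map_mxB map_scalar_mx /=.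
  rewrite horner_evalE /a hornerXsubC subrr raddf0 sub0r.
  rewrite map_trmx -map_mxM -map_mx_comp map_mx_id => [|x]; last first.
    by rewrite /= horner_evalE hornerC.
  rewrite -unitfE -unitmxE -scaleN1r unitmxZ ?unitrN1 //.
  exact: incidence_mul_tr_unit.
have q0 : q != 0 by apply: contraNneq qN => ->; rewrite root0.
have aX0 k : a ^+ k != 0 by rewrite expf_neq0 ?polyXsubC_eq0.
have := congr1 (mup (- 2%:R)) chE.
have ch0 : char_poly (adjmx C (line_graph X)) != 0.
  exact: monic_neq0 (char_poly_monic _).
rewrite (mupM _ (aX0 n) ch0) (mupM _ (aX0 m) q0) (mupNroot qN) addn0.
by rewrite !mup_XsubCX eqxx spectrumE mu_prod_XsubC.
Qed.

Lemma energy_line_graph X : signless_ge2 X ->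
  energy C (line_graph X) = 4%:R * ((gsize X)%:R - (gorder X)%:R).
Proof.
move=> X2.
(* [|a|] exceeds [a] by 4 at -2 and by 0 elsewhere on the spectrum; as the spectrum sums to 0, the
   energy is 4 times the multiplicity of -2. *)
have normE a : a \in spectrum C (line_graph X) ->
    `|a| = a + (4 * (a == - 2%:R))%:R.
  rewrite mem_spectrum => /(eigenvalue_line_graph X2) [->|a_ge0].
    by rewrite eqxx normrN ger0_norm ?ler0n // muln1 (natrD _ 2 2) addKr.
  rewrite ger0_norm // (_ : _ == _ = false) ?addr0 //.
  by apply: contraTF a_ge0 => /eqP ->; rewrite oppr_ge0 lern0.
rewrite /energy (eq_big_seq _ normE) big_split /= sum_spectrum add0r -natr_sum.
rewrite -big_distrr /= natrM; congr (_ * _).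
rewrite -card_line_graph -(mult_neg2_spectrum X2) natrD addrAC subrr add0r.
by rewrite -sum1_count [in RHS]big_mkcond /=; congr _%:R.
Qed.

Lemma property_rho_line_graph X :
  signless_ge2 X -> property_rho C (line_graph X).
Proof.
by move=> X2 a /(eigenvalue_line_graph X2) [] // /le_gtF ->.
Qed.

(** * Means, deviations and regular graphs *)

Definition mean (T : finType) (v : T -> C) : C := (\sum_x v x) / #|T|%:R.

Lemma sum_mean (T : finType) (v : T -> C) : (0 < #|T|)%N ->
  \sum_x v x = mean v * #|T|%:R.
Proof. by move=> T_gt0; rewrite divfK // pnatr_eq0 -lt0n. Qed.

Lemma sum_norm2_centered (T : finType) (v : T -> C) : (0 < #|T|)%N ->
  \sum_x `|v x - mean v| ^+ 2
    = \sum_x `|v x| ^+ 2 - `|mean v| ^+ 2 * #|T|%:R.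
Proof.
move=> T_gt0; have sE := sum_mean v T_gt0; move: (mean v) sE => m sE.
under eq_bigr => x _.
  rewrite normCK rmorphB /= mulrBl !mulrBr -normCK -normCK; over.
rewrite !sumrB sumr_const -mulr_suml sE -mulr_sumr -rmorph_sum /= sE.
rewrite [(m * _)^*]rmorphM /= conjC_nat -[#|xpredT|]/#|T| -mulr_natr !normCK.
by ring.
Qed.

(** Write [v = u + m] with [u] of sum 0. Constants are eigenvectors of [D + A] for [2 r], so the
    cross terms vanish, and the form of [u] is nonnegative. *)
Lemma signless_form_regular X (r : nat) (v : X -> C) :
    (0 < #|X|)%N -> regular X r ->
  (2 * r)%:R * (`|mean v| ^+ 2 * #|X|%:R) <= signless_form v.
Proof.
move=> X_gt0 reg; have sE := sum_mean v X_gt0; move: (mean v) sE => m sE.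
pose u x := v x - m.
have u0 : \sum_x u x = 0 by rewrite sumrB sumr_const sE mulr_natr subrr.
have deg (x : X) : \sum_(y | adj x y) (1 : C) = r%:R.
  by rewrite -(reg x) -sum1dep_card natr_sum.
have nb : \sum_x \sum_(y | adj x y) u y = 0.
  transitivity (r%:R * \sum_x u x); last by rewrite u0 mulr0.
  rewrite (exchange_big_dep predT) //= mulr_sumr.
  apply: eq_bigr => y _; rewrite -(deg y) mulr_suml.
  by apply: eq_big => [x|x _]; rewrite ?mul1r // adj_sym.
suff -> : signless_form v
    = signless_form u + (2 * r)%:R * (`|m| ^+ 2 * #|X|%:R).
  by rewrite lerDr signless_form_ge0.
transitivity (\sum_x (\sum_(y | adj x y) (u x + u y) * (u x)^*
   + r%:R * (m *+ 2 * (u x)^* + m^* * u x + `|m| ^+ 2 *+ 2)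
   + m^* * \sum_(y | adj x y) u y)).
  apply: eq_bigr => x _; rewrite mulr_sumr -(deg x) mulr_suml -!big_split /=.
  apply: eq_bigr => y _; rewrite /u normCK rmorphB /=; ring.
rewrite !big_split /= -[X in _ + X]mulr_sumr nb mulr0 addr0.
rewrite -[X in _ + X]mulr_sumr !big_split /= !sumr_const -!mulr_sumr.
rewrite -rmorph_sum u0 /= rmorph0 -[#|xpredT|]/#|X| /signless_form natrM.
by rewrite -(mulr_natr _ #|X|); ring.
Qed.

(** * Sums, degrees and the signless bound in the join *)

Lemma sum_gjoin (V : nmodType) (G : sgraph) (H : G -> sgraph)
    (F : gjoin H -> V) :
  \sum_u F u = \sum_i \sum_(x : H i) F (Tagged H x).
Proof.
rewrite (sig_big_dep _ _ (fun i (x : H i) => F (Tagged H x))) /=.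
by apply: eq_bigr => -[].
Qed.

Lemma sum_gjoin_adj (V : nmodType) (G : sgraph) (H : G -> sgraph)
    (F : gjoin H -> V) (i : G) (x : H i) :
  \sum_(w : gjoin H | adj (Tagged H x : gjoin H) w) F w
    = \sum_(y | adj x y) F (Tagged H y)
      + \sum_(j | adj i j) \sum_(y : H j) F (Tagged H y).
Proof.
transitivity (\sum_j \sum_(y : H j | gjoin_adj (Tagged H x) (Tagged H y))
                F (Tagged H y)).
  rewrite (sig_big_dep xpredT (fun j (y : H j) => _) (fun j (y : H j) => _)).
  by apply: eq_big => [[]|[]].
rewrite (bigD1 i) //=; congr (_ + _).
  apply: eq_bigl => y.
  by rewrite /gjoin_adj /= adj_irr eqxx tagged_asE.
rewrite [RHS]big_mkcond [LHS]big_mkcond; apply: eq_bigr => j _ /=.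
rewrite /gjoin_adj /=; case: eqVneq => [->|ij] /=; first by rewrite adj_irr.
under eq_bigl do rewrite orbF.
by case: (adj i j); rewrite // big_pred0.
Qed.

Lemma degree_gjoin (G : sgraph) (H : G -> sgraph) (i : G) (x : H i) :
  @degree (gjoin H) (Tagged H x)
    = (degree x + \sum_(j | adj i j) #|H j|)%N.
Proof.
rewrite /degree -!sum1dep_card.
etransitivity; first exact: (sum_gjoin_adj (fun=> 1%N)).
by congr (_ + _)%N; apply: eq_bigr => j _; rewrite -sum1_card.
Qed.

Section RegularJoin.
Variables (G : sgraph) (H : G -> sgraph) (r : G -> nat).
Hypothesis no_isolated : forall i : G, exists j, adj i j.
Hypothesis H_gt0 : forall i, (0 < #|H i|)%N.
Hypothesis H_regular : forall i, regular (H i) (r i).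
Hypothesis r_gt0 : forall i, (0 < r i)%N.

Let H_gt1 i : (1 < #|H i|)%N.
Proof.
have /card_gt0P [x _] := H_gt0 i.
have : (0 < #|[set y | adj x y]|)%N by rewrite H_regular.
rewrite card_gt0 => /set0Pn [y]; rewrite inE => /adj_neq xy.
by apply/card_gt1P; exists x, y.
Qed.

(** A single neighbouring part suffices, having two vertices by [H_gt1]. This 2 is the constant of
    the signless bound on deviations; one more neighbour inside [H i] gives minimum degree 3. *)
Let nbr_card i : (2 <= \sum_(j | adj i j) #|H j|)%N.
Proof.
have [j ij] := no_isolated i; rewrite (bigD1 j) //=.
exact: leq_trans (H_gt1 j) (leq_addr _ _).
Qed.

Lemma min_degree_gjoin (u : gjoin H) : (3 <= degree u)%N.
Proof.
case: u => i x; rewrite degree_gjoin.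
by apply: (leq_add (_ : 1 <= _)%N (nbr_card i)); rewrite /degree H_regular.
Qed.

(* With [m i] the mean of [v] over [H i], the edges inside [H i] contribute at
   least [2 |m i|^2 #|H i|] by regularity, while those between distinct parts
   contribute the deviation of [v] from [m i], weighted by the number of outer
   neighbours, plus a nonnegative weighted form of [m] on [G]. *)
Lemma signless_ge2_gjoin : signless_ge2 (gjoin H).
Proof.
move=> v; pose vi i x := v (Tagged H (x : H i)).
pose p i : C := #|H i|%:R; pose m i := mean (vi i).
pose N i := \sum_x `|vi i x| ^+ 2.
have sE i : \sum_x vi i x = m i * p i by exact: sum_mean.
have formE : signless_form v = \sum_i (signless_form (vi i)
    + (\sum_(j | adj i j) p j) * (N i - `|m i| ^+ 2 * p i)
    + \sum_(j | adj i j) p i * p j * ((m i + m j) * (m i)^*)).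
  rewrite /signless_form sum_gjoin; apply: eq_bigr => i _.
  under eq_bigr do rewrite sum_gjoin_adj.
  rewrite big_split /= -addrA; congr (_ + _).
  rewrite exchange_big /= mulr_suml -big_split /=.
  apply: eq_bigr => j ij.
  transitivity (\sum_x (p j * `|vi i x| ^+ 2 + m j * p j * (vi i x)^*)).
    apply: eq_bigr => x _; rewrite -mulr_suml big_split /= sumr_const.
    by rewrite sE -[#|xpredT|]/#|H j| -mulr_natr normCK -/(vi i x) -/(p j); ring.
  rewrite big_split /= -mulr_sumr -mulr_sumr -rmorph_sum /= sE.
  by rewrite [(m i * _)^*]rmorphM /= conjC_nat normCK -/(N i); ring.
rewrite formE sum_gjoin mulr_sumr big_split /= -[leLHS]addr0 lerD //; last first.
  apply: weighted_form_ge0 => [i j|i j]; first by rewrite mulrC.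
  by rewrite mulr_ge0 ?ler0n.
apply: ler_sum => i _; rewrite -/(N i).
(* The mean part is bounded using [2 * r i >= 2], the deviation part using the outer neighbours, at
   least two in number. *)
have NE : N i = `|m i| ^+ 2 * p i + (N i - `|m i| ^+ 2 * p i).
  by rewrite addrC subrK.
rewrite {1}NE mulrDr lerD //.
  apply: le_trans _ (signless_form_regular (vi i) (H_gt0 i) (@H_regular i)).
  rewrite ler_wpM2r ?ler_nat ?mulr_ge0 ?exprn_ge0 ?ler0n //.
  by rewrite -{1}[2%N]muln1 leq_mul2l r_gt0 orbT.
rewrite ler_wpM2r //; last by rewrite -natr_sum ler_nat.
rewrite -(sum_norm2_centered _ (H_gt0 i)).
by rewrite sumr_ge0 // => x _; rewrite exprn_ge0.
Qed.

End RegularJoin.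

End SignlessLaplacian.

(** * Assembly for the iterated line graphs of the join *)

Lemma gconnected_adj (G : sgraph) : (2 <= gorder G)%N -> gconnected G ->
  forall i : G, exists j, adj i j.
Proof.
move=> /card_gt1P [a [b [_ _ ab]]] conn i.
have [j ij] : exists j, i != j.
  by case: (eqVneq i a) ab => [->|]; [exists b | exists a].
have /connectP [[|k s] /=] := conn i j.
  by move=> _ /eqP; rewrite eq_sym (negPf ij).
by move=> /andP [ik _] _; exists k.
Qed.

Theorem theorem4p6 (C : numClosedFieldType) (G : sgraph) (H : G -> sgraph)
    (r p : G -> nat)
    (hn : (2 <= gorder G)%N) (hG : gconnected G)
    (hp : forall i : G, gorder (H i) = p i)
    (hp0 : forall i : G, (1 <= p i)%N)
    (hr : forall i : G, regular (H i) (r i))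
    (hr1 : forall i : G, (1 <= r i)%N) :
  let GG := gjoin H in
  let n_ (k : nat) := gorder (iter_line k GG) in
  [/\ forall k : nat, (1 <= k)%N -> property_rho C (iter_line k GG),
      forall (k m' : nat) (G' : sgraph),
        gorder G' = n_ k -> gsize G' = m' ->
        spanning_subgraph (iter_line k GG) G' ->
        property_rho C (line_graph G') /\
        energy C (line_graph G') = 4%:R * (m'%:R - (n_ k)%:R)
    & forall (k m' : nat) (G' G'' : sgraph),
        gorder G' = n_ k -> gsize G' = m' ->
        spanning_subgraph (iter_line k GG) G' ->
        gorder G'' = n_ k -> gsize G'' = m' ->
        spanning_subgraph (iter_line k GG) G'' ->
        equienergetic C (line_graph G') (line_graph G'')].
Proof.
move=> GG n_.
have H_gt0 i : (0 < #|H i|)%N by rewrite -/(gorder (H i)) hp.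
have nbr := gconnected_adj hn hG.
(* Minimum degree 3 passes from the join to all its iterated line graphs, and gives the signless
   bound for every [k >= 1]. *)
have deg3 k (x : iter_line k GG) : (3 <= degree x)%N.
  elim: k x => [|k IHk] x; first exact: min_degree_gjoin hr hr1 x.
  exact: ltnW (min_degree_line_graph IHk x).
have ge2 k : signless_ge2 C (iter_line k GG).
  case: k => [|k]; first exact: signless_ge2_gjoin hr hr1.
  exact: signless_ge2_line_graph (deg3 k).
have en k m' (G' : sgraph) : gorder G' = n_ k -> gsize G' = m' ->
    spanning_subgraph (iter_line k GG) G' ->
    property_rho C (line_graph G') /\
    energy C (line_graph G') = 4%:R * (m'%:R - (n_ k)%:R).
  move=> <- <- /signless_ge2_spanning /(_ (ge2 k)) G'2.
  by split; [exact: property_rho_line_graph | exact: energy_line_graph].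
split=> [[//|k] _||k m' G' G'' o1 s1 sp1 o2 s2 sp2]; last 2 first.
- exact: en.
- split; first by rewrite /gorder !card_line_graph s1.
  have [_ ->] := en k m' G' o1 s1 sp1.
  by have [_ ->] := en k m' G'' o2 s2 sp2.
(* [iter_line k.+1 GG] is itself the line graph of [iter_line k GG]. *)
- exact: property_rho_line_graph (ge2 k).
Qed.
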